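(* Let $\mathcal{H}$ be a Hilbert space, $\mathcal{C}\subset\mathcal{H}$ a convex compact subset, and $f:\mathcal{H}\to(-\infty,+\infty]$ a convex function. Let $\sigma^\star\in\mathcal{C}$ with $f(\sigma^\star)<+\infty$. Then $\sigma^\star$ minimizes $f$ over $\mathcal{C}$, i.e. $\min_{\sigma\in\mathcal{C}}f(\sigma)=f(\sigma^\star)$, if and only if for all $\sigma\in\mathcal{C}$ $$f'(\sigma^\star;\sigma-\sigma^\star)\geq 0.$$
   Context: A function $f:\mathcal{H}\to(-\infty,+\infty]$ is convex if $f((1-t)A+tB)\le(1-t)f(A)+tf(B)$ for all $A,B\in\mathcal{H}$, $t\in[0,1]$ (with the usual conventions for $+\infty$); equivalently, its domain $\mathrm{dom} f=\{A: f(A)<+\infty\}$ is convex and $f$ is convex on it. For $A\in\mathrm{dom} f$ and $B\in\mathcal{H}$, the directional derivative is $$f'(A;B)=\lim_{t\to0^+}\frac{f(A+tB)-f(A)}{t},$$ which for convex $f$ always exists as an element of $[-\infty,+\infty]$. *)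

(* Defs.v *)
From HB Require Import structures.
From mathcomp Require Import all_boot all_order all_algebra.
From mathcomp Require Import sesquilinear.
From mathcomp Require Import all_classical all_reals all_analysis.
From mathcomp Require Import complex.

Set Implicit Arguments.
Unset Strict Implicit.
Unset Printing Implicit Defensive.

Import Order.TTheory GRing.Theory Num.Theory.
Import numFieldNormedType.Exports.

Local Open Scope classical_set_scope.
Local Open Scope ring_scope.

(* MathComp / MathComp-Analysis. A Hilbert space is real or complex: it is a
   completeNormedModType over scalar_field R k whose norm satisfies
   `|x| ^+ 2 = dot x x for an inner product dot, i.e. a positive definite form
   linear in its first and conjugate-linear in its second argument. In R[i],
   `|x| is a nonnegative real element, and 0 <= z forces z to be real, so that
   positivity of dot and the weights in {i01 _} used by convex_set have their
   usual meaning in the complex case too. *)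
Variant scalar_kind := RealScalars | ComplexScalars.

Definition scalar_field (R : realType) (k : scalar_kind) : numFieldType :=
  match k with
  | RealScalars => R
  | ComplexScalars => complex R
  end.

Definition scalar_of_real (R : realType) (k : scalar_kind) : R -> scalar_field R k :=
  match k with
  | RealScalars => idfun
  | ComplexScalars => @real_complex R
  end.

Definition scalar_conj (R : realType) (k : scalar_kind) :
    scalar_field R k -> scalar_field R k :=
  match k with
  | RealScalars => idfun
  | ComplexScalars => @conjc R
  end.

(* On \bar R one has 0 * +oo = 0, so the inequality at the endpoints t = 0, 1
   is trivial even where f is infinite; and, f never being -oo, the sum on the
   right is never of the form +oo - oo. *)
Definition convex_efun (R : realType) (k : scalar_kind)
    (H : lmodType (scalar_field R k)) (f : H -> \bar R) :=
  forall (A B : H) (t : R), 0 <= t <= 1 ->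
  (f (scalar_of_real k (1 - t) *: A + scalar_of_real k t *: B)%R
     <= (1 - t)%:E * f A + t%:E * f B)%E.

(* The limit is taken in \bar R, so -oo and +oo are allowed values. For convex
   f with values in ]-oo, +oo] and f A finite it exists, hence lim does not
   return its default value there. *)
Definition dir_derive (R : realType) (k : scalar_kind)
    (H : lmodType (scalar_field R k)) (f : H -> \bar R) (A B : H) : \bar R :=
  lim ((f (A + scalar_of_real k t *: B)%R - f A) * (t^-1)%:E @[t --> 0^'+])%E.

Definition minimizes (R : realType) (T : Type) (f : T -> \bar R)
    (C : set T) (s : T) :=
  C s /\ forall x, C x -> (f s <= f x)%E.

(* Main.v *)
Require Import Defs.
From mathcomp Require Import all_boot all_order all_algebra.
From mathcomp Require Import sesquilinear.
From mathcomp Require Import all_classical all_reals all_analysis.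
From mathcomp Require Import complex ring.

Set Implicit Arguments.
Unset Strict Implicit.
Unset Printing Implicit Defensive.

Import Order.TTheory GRing.Theory Num.Theory.
Import numFieldNormedType.Exports.

Local Open Scope classical_set_scope.
Local Open Scope ring_scope.

(** Along a ray from a point [A] of the domain, the difference quotients of a
    convex function are nondecreasing, so the directional derivative at [A] is
    their infimum over [0 < t <= 1]. It is therefore nonnegative if and only if
    all these quotients are. In the direction [s - A] the quotient at [t = 1]
    is [f s - f A], and for [0 < t <= 1] the point [A + t (s - A)] stays in any
    convex set containing [A] and [s]. *)

Lemma scalar_of_real1 (R : realType) (k : scalar_kind) :
  @scalar_of_real R k 1 = 1.
Proof. by case: k. Qed.

Lemma scalar_of_realB (R : realType) (k : scalar_kind) (x y : R) :
  scalar_of_real k (x - y) = scalar_of_real k x - scalar_of_real k y.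
Proof. by case: k => //=; rewrite rmorphB. Qed.

Lemma scalar_of_realM (R : realType) (k : scalar_kind) (x y : R) :
  scalar_of_real k (x * y) = scalar_of_real k x * scalar_of_real k y.
Proof. by case: k => //=; rewrite rmorphM. Qed.

Lemma scalar_of_real_itv01 (R : realType) (k : scalar_kind) (t : R) :
  0 <= t <= 1 -> 0 <= scalar_of_real k t <= 1.
Proof. by case: k => //=; rewrite !lecR. Qed.

(** Translates between the ray form of [dir_derive] and the weighted form of [convex_efun] and
    [convex_set]. *)
Lemma segmentE (R : realType) (k : scalar_kind)
    (H : lmodType (scalar_field R k)) (A B : H) (t : R) :
  A + scalar_of_real k t *: (B - A) =
  scalar_of_real k (1 - t) *: A + scalar_of_real k t *: B.
Proof.
rewrite scalar_of_realB scalar_of_real1 scalerBl scale1r scalerBr.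
by rewrite addrAC addrA.
Qed.

Lemma convex_set_segment (R : realType) (k : scalar_kind)
    (H : lmodType (scalar_field R k)) (C : set (convex_lmodType H)) (A B : H)
    (t : R) :
  convex_set C -> C A -> C B -> 0 <= t <= 1 ->
  C (A + scalar_of_real k t *: (B - A)).
Proof.
move=> C_convex CA CB /(scalar_of_real_itv01 k)/andP[t0 t1].
(* [B] comes first because the library's [conv] puts the weight [t] on its first point. *)
have := C_convex B A (Itv01 t0 t1) (mem_set CB) (mem_set CA).
by rewrite inE /conv/= addrC segmentE scalar_of_realB scalar_of_real1.
Qed.

Definition diff_quotient (R : realType) (k : scalar_kind)
    (H : lmodType (scalar_field R k)) (f : H -> \bar R) (A B : H) (t : R) :=
  ((f (A + scalar_of_real k t *: B)%R - f A) * (t^-1)%:E)%E.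

(** The point at parameter [s] lies on the segment from [A] to the point at parameter [t], with
    weight [s / t] on the latter; convexity there bounds the increment of [f] at [s] by [s / t]
    times that at [t]. *)
Lemma diff_quotient_nondecreasing (R : realType) (k : scalar_kind)
    (H : lmodType (scalar_field R k)) (f : H -> \bar R) (A B : H) (s t : R) :
  (forall x, (-oo < f x)%E) -> convex_efun f -> (f A < +oo)%E ->
  0 < s -> s <= t -> (diff_quotient f A B s <= diff_quotient f A B t)%E.
Proof.
move=> f_gtNy f_convex fA_lty s_gt0 le_st.
have t_gt0 : 0 < t := lt_le_trans s_gt0 le_st.
have r01 : 0 <= s / t <= 1.
  by rewrite ler_pdivrMr// mul1r le_st andbT divr_ge0// ltW.
have := f_convex A (A + scalar_of_real k t *: B) _ r01.
rewrite -segmentE addrAC subrr add0r scalerA -scalar_of_realM divfK ?gt_eqF//.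
have := f_gtNy (A + scalar_of_real k s *: B).
have := f_gtNy (A + scalar_of_real k t *: B).
have := f_gtNy A.
rewrite /diff_quotient.
case: (f A) fA_lty => // a _ _.
case: (f (A + scalar_of_real k t *: B)) => [y| |] // _.
  case: (f (A + scalar_of_real k s *: B)) => [x| |] // _.
  rewrite -!EFinB -!EFinM -EFinD !lee_fin => lex.
  (* With the denominator [s] cleared, what remains is the convexity bound [lex] rearranged. *)
  rewrite ler_pdivrMr// lerBlDr (le_trans lex)//.
  rewrite [leLHS](_ : _ = (y - a) / t * s + a)//.
  by ring.
(* If [f] is [+oo] at parameter [t], the larger quotient is [+oo]. *)
by move=> _ _; rewrite addye// gt0_mulye ?lte_fin ?invr_gt0// leey.
Qed.

Lemma dir_derive_ereal_inf (R : realType) (k : scalar_kind)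
    (H : lmodType (scalar_field R k)) (f : H -> \bar R) (A B : H) :
  (forall x, (-oo < f x)%E) -> convex_efun f -> (f A < +oo)%E ->
  dir_derive f A B = ereal_inf (diff_quotient f A B @` `]0, 1]).
Proof.
move=> f_gtNy f_convex fA_lty.
(* A monotone function has its infimum as right limit at 0, possibly [-oo]. The bound [BRight 1]
   keeps [t = 1] among the competing values. *)
apply: cvg_lim => //; apply: (nondecreasing_at_right_cvge (BRight 1)).
  by rewrite bnd_simp.
move=> s t; rewrite in_itv/= => /andP[s_gt0 _] _.
exact: diff_quotient_nondecreasing.
Qed.

Theorem theorem1 (R : realType) (k : scalar_kind)
  (H : completeNormedModType (scalar_field R k))
  (dot : {dot H for @scalar_conj R k})
  (norm_dot : forall x : H, `|x| ^+ 2 = dot x x)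
  (C : set H) (C_convex : convex_set (C : set (convex_lmodType H)))
  (C_compact : compact C)
  (f : H -> \bar R) (f_gtNy : forall x : H, (-oo < f x)%E)
  (f_convex : convex_efun f)
  (sstar : H) (sstar_in_C : C sstar) (f_sstar : (f sstar < +oo)%E) :
  minimizes f C sstar <->
  forall s : H, C s -> (0 <= dir_derive f sstar (s - sstar))%E.
Proof.
(* Finiteness lets [sube_ge0] exchange [0 <= f x - f sstar] and [f sstar <= f x] in both directions,
   even where [f x] is [+oo]. *)
have fin_sstar : f sstar \is a fin_num by rewrite fin_numElt f_gtNy.
split=> [[_ le_f] s Cs|ge0_dir].
  rewrite dir_derive_ereal_inf//.
  apply: le_ereal_inf_tmp => _ /= [t + <-].
  rewrite in_itv/= => /andP[t_gt0 t_le1].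
  apply: mule_ge0; last by rewrite lee_fin invr_ge0 ltW.
  rewrite sube_ge0 ?fin_sstar//; apply: le_f.
  by apply: (convex_set_segment C_convex) => //; rewrite (ltW t_gt0).
split=> // s Cs.
have: (dir_derive f sstar (s - sstar) <= f s - f sstar)%E.
  rewrite dir_derive_ereal_inf//; apply: ereal_inf_lbound.
  exists 1; first by rewrite /= in_itv/= ltr01 lexx.
  by rewrite /diff_quotient scalar_of_real1 scale1r subrKC invr1 mule1.
by move/(le_trans (ge0_dir s Cs)); rewrite sube_ge0 ?fin_sstar.
Qed.
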